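(* Let $n\ge 1$ and $\sigma_1\ge\dots\ge\sigma_{n-1}\ge 1$, and let $\phi$ be the Lorentzian inner product on the Heisenberg Lie algebra $\mathfrak{h}_{2n+1}$ represented in the basis $\{f_1,g_1,\dots,f_n,g_n,z\}$ by the block diagonal matrix with blocks $\operatorname{diag}\{\sigma_1,\sigma_1,\dots,\sigma_{n-1},\sigma_{n-1}\}$ and $\begin{bmatrix}1&0&0\\0&0&1\\0&1&0\end{bmatrix}$. Then $\phi$ is an algebraic Ricci soliton, $\operatorname{Ric}=\eta\operatorname{Id}+D$, with $\eta=0$ and $D=\operatorname{Ric}$, where $D=\operatorname{Ric}$ is a derivation of $\mathfrak{h}_{2n+1}$. In particular $\phi$ is a steady algebraic Ricci soliton.
   Context: The Heisenberg Lie algebra $\mathfrak{h}_{2n+1}$ is the real Lie algebra with basis $\{f_1,g_1,\dots,f_n,g_n,z\}$ whose only nonzero brackets of basis elements (up to antisymmetry) are $[f_i,g_i]=z$, $i=1,\dots,n$. For $n=1$ there are no $\sigma_k$. A Lorentzian inner product is a nondegenerate symmetric bilinear form of signature $(2n,1)$; an orthonormal basis $\{v_1,\dots,v_m\}$ satisfies $\langle v_i,v_j\rangle=0$ for $i\ne j$, $\langle v_i,v_i\rangle=1$ for $i<m$, and $\langle v_m,v_m\rangle=-1$. The Levi-Civita connection of $(\mathfrak{g},\langle\cdot,\cdot\rangle)$ is the bilinear map $(u,v)\mapsto\nabla_uv$ on $\mathfrak{g}$ determined by the Koszul formula $2\langle\nabla_uv,w\rangle=\langle[u,v],w\rangle+\langle[w,u],v\rangle+\langle[w,v],u\rangle$.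 The curvature is $R_{uv}w=\nabla_{[u,v]}w-\nabla_u\nabla_vw+\nabla_v\nabla_uw$, and the Ricci operator is $\operatorname{Ric}(u)=\sum_{k=1}^{m}\langle v_k,v_k\rangle R_{v_ku}v_k$ for an orthonormal basis $\{v_1,\dots,v_m\}$. A Lorentzian inner product on a Lie algebra $\mathfrak{g}$ is an algebraic Ricci soliton if $\operatorname{Ric}=\eta\operatorname{Id}_{\mathfrak{g}}+D$ for some $\eta\in\mathbb{R}$ and some derivation $D$ of $\mathfrak{g}$, i.e. a linear map with $[D(u),v]+[u,D(v)]=D[u,v]$ for all $u,v\in\mathfrak{g}$. It is called steady if $\eta=0$. *)

(* Defs.v *)
From HB Require Import structures.
From mathcomp Require Import all_boot all_order all_algebra.
From mathcomp Require Import zify ring.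

Set Implicit Arguments.
Unset Strict Implicit.
Unset Printing Implicit Defensive.

Import Order.TTheory GRing.Theory Num.Theory.

Local Open Scope ring_scope.

HB.mixin Record Vector_isLieAlgebra (R : fieldType) (V : Type)
    of Vector R V := {
  lie : V -> V -> V;
  lie_linearl : forall v, linear (lie ^~ v);
  lie_linearr : forall u, linear (lie u);
  liexx : forall u, lie u u = 0;
  lie_jacobi : forall u v w,
    lie u (lie v w) + lie v (lie w u) + lie w (lie u v) = 0
}.

#[short(type="lieAlgType")]
HB.structure Definition LieAlgebra (R : fieldType) :=
  {V of Vector_isLieAlgebra R V & Vector R V}.

Section MetricLieAlgebra.
Context {R : realFieldType} {V : lieAlgType R}.
Implicit Types (phi : {symmetric V}) (nabla : {bilinear V -> V -> V}).
Implicit Types (e : seq V) (D Ric : 'End(V)) (eta : R) (u v w : V).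

Definition has_signature phi (p q : nat) : Prop :=
  exists e, [/\ basis_of fullv e, pairwise_orthogonal phi e,
    count (fun v => 0 < phi v v) e = p & count (fun v => phi v v < 0) e = q].

Definition lorentzian phi : Prop :=
  nondegenerate phi /\ has_signature phi (\dim {:V}).-1 1.

Definition orthonormal_basis phi e : Prop :=
  basis_of fullv e /\
  forall i j, (i < size e)%N -> (j < size e)%N ->
    phi e`_i e`_j =
      if i != j then 0 else if (i.+1 < size e)%N then 1 else -1.

Definition levi_civita phi nabla : Prop :=
  forall u v w,
    2 * phi (nabla u v) w = phi (lie u v) w + phi (lie w u) v + phi (lie w v) u.

Definition curvature nabla u v w : V :=
  nabla (lie u v) w - nabla u (nabla v w) + nabla v (nabla u w).

(* For a nondegenerate [phi] at most one [nabla] satisfies the Koszul formula,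
   and the trace does not depend on the orthonormal basis, so at most one [Ric]
   qualifies. *)
Definition ricci_operator phi Ric : Prop :=
  exists nabla, [/\ levi_civita phi nabla,
    exists e, orthonormal_basis phi e &
    forall e, orthonormal_basis phi e -> forall u,
      Ric u = \sum_(v <- e) phi v v *: curvature nabla v u v].

Definition derivation D : Prop :=
  forall u v, lie (D u) v + lie u (D v) = D (lie u v).

Definition algebraic_ricci_soliton_with phi eta D : Prop :=
  [/\ lorentzian phi, derivation D &
    exists2 Ric, ricci_operator phi Ric & Ric = eta *: \1%VF + D].

Definition steady_algebraic_ricci_soliton phi : Prop :=
  exists D, algebraic_ricci_soliton_with phi 0 D.

End MetricLieAlgebra.

(* Coordinates are taken in the ordered basis f_1, g_1, ..., f_n, g_n, z;
   with 0-based indices f_(i+1), g_(i+1), z sit at 2i, 2i+1, 2n. *)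
Definition heisenberg (R : fieldType) (n : nat) : Type := 'rV[R]_(n.*2.+1).

HB.instance Definition _ (R : fieldType) (n : nat) :=
  Vector.copy (heisenberg R n) 'rV[R]_(n.*2.+1).

Section Heisenberg.
Context {R : fieldType} {n : nat}.
Implicit Types (u v w : heisenberg R n) (i j : 'I_n).

Definition heis_basis (k : 'I_(n.*2.+1)) : heisenberg R n := delta_mx 0 k.

Definition fidx i : 'I_(n.*2.+1) := inord i.*2.
Definition gidx i : 'I_(n.*2.+1) := inord i.*2.+1.

Definition heis_f i := heis_basis (fidx i).
Definition heis_g i := heis_basis (gidx i).
Definition heis_z := heis_basis ord_max.

Definition heis_omega u v : R :=
  \sum_(i < n) (u 0 (fidx i) * v 0 (gidx i) - u 0 (gidx i) * v 0 (fidx i)).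

Definition heis_lie u v : heisenberg R n := heis_omega u v *: heis_z.

Lemma heis_omega_linearl v : linear_for *%R (heis_omega ^~ v).
Proof.
move=> a x y; rewrite /heis_omega mulr_sumr -big_split /=.
apply: eq_bigr => i _; rewrite !mxE; ring.
Qed.

Lemma heis_omega_linearr u : linear_for *%R (heis_omega u).
Proof.
move=> a x y; rewrite /heis_omega mulr_sumr -big_split /=.
apply: eq_bigr => i _; rewrite !mxE; ring.
Qed.

Lemma val_fidx i : fidx i = i.*2 :> nat.
Proof. by rewrite inordK // ltnS leq_double ltnW. Qed.

Lemma val_gidx i : gidx i = i.*2.+1 :> nat.
Proof. by rewrite inordK // ltnS ltn_double. Qed.

Lemma fidx_eq i j : (fidx i == fidx j) = (i == j).
Proof. by rewrite -!val_eqE /= !val_fidx; lia. Qed.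

Lemma gidx_eq i j : (gidx i == gidx j) = (i == j).
Proof. by rewrite -!val_eqE /= !val_gidx; lia. Qed.

Lemma fgidx_eq i j : (fidx i == gidx j) = false.
Proof. by rewrite -!val_eqE /= val_fidx val_gidx; lia. Qed.

Lemma fidx_max i : (fidx i == ord_max) = false.
Proof. by rewrite -val_eqE /= val_fidx; have := ltn_ord i; lia. Qed.

Lemma gidx_max i : (gidx i == ord_max) = false.
Proof. by rewrite -val_eqE /= val_gidx; have := ltn_ord i; lia. Qed.

Lemma heis_omegaz u : heis_omega u heis_z = 0.
Proof.
apply: big1 => i _; rewrite !mxE fidx_max gidx_max /= !mulr0 subrr //.
Qed.

Lemma heis_lie_linearl v : linear (heis_lie ^~ v).
Proof.
by move=> a x y; rewrite /heis_lie heis_omega_linearl scalerDl scalerA.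
Qed.

Lemma heis_lie_linearr u : linear (heis_lie u).
Proof.
by move=> a x y; rewrite /heis_lie heis_omega_linearr scalerDl scalerA.
Qed.

Lemma heis_liexx u : heis_lie u u = 0.
Proof.
rewrite /heis_lie /heis_omega big1 ?scale0r // => i _.
by rewrite mulrC subrr.
Qed.

Lemma heis_lieA0 u v w : heis_lie u (heis_lie v w) = 0.
Proof.
rewrite {1}/heis_lie /(heis_lie v w).
have := heis_omega_linearr u (heis_omega v w) heis_z 0.
rewrite addr0 heis_omegaz mulr0 add0r => ->.
by rewrite /heis_omega big1 ?scale0r // => i _; rewrite !mxE !mulr0 subrr.
Qed.

Lemma heis_lie_jacobi u v w :
  heis_lie u (heis_lie v w) + heis_lie v (heis_lie w u) +
  heis_lie w (heis_lie u v) = 0.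
Proof. by rewrite !heis_lieA0 !addr0. Qed.

End Heisenberg.

HB.instance Definition _ (R : fieldType) (n : nat) :=
  Vector_isLieAlgebra.Build R (heisenberg R n)
    heis_lie_linearl heis_lie_linearr heis_liexx heis_lie_jacobi.

Section HeisenbergBrackets.
Context {R : fieldType} {n : nat}.
Implicit Types (u : heisenberg R n) (i j k : 'I_n).

Lemma heis_ff i k : (heis_f i : heisenberg R n) 0 (fidx k) = (k == i)%:R.
Proof. by rewrite mxE fidx_eq. Qed.

Lemma heis_fg i k : (heis_f i : heisenberg R n) 0 (gidx k) = 0.
Proof. by rewrite mxE [gidx k == _]eq_sym fgidx_eq. Qed.

Lemma heis_gf i k : (heis_g i : heisenberg R n) 0 (fidx k) = 0.
Proof. by rewrite mxE fgidx_eq. Qed.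

Lemma heis_gg i k : (heis_g i : heisenberg R n) 0 (gidx k) = (k == i)%:R.
Proof. by rewrite mxE gidx_eq. Qed.

Let heisE := (heis_ff, heis_fg, heis_gf, heis_gg).

Lemma lie_fg i j :
  lie (heis_f i) (heis_g j) = (if i == j then heis_z else 0) :> heisenberg R n.
Proof.
rewrite /lie /= /heis_lie /heis_omega (bigD1 i) //= big1 => [|k /negPf ki].
  rewrite !heisE eqxx mul1r mulr0 subr0 addr0.
  by case: eqP; rewrite ?scale1r ?scale0r.
by rewrite !heisE ki !mul0r subrr.
Qed.

Lemma lie_ff i j : lie (heis_f i) (heis_f j) = 0 :> heisenberg R n.
Proof.
rewrite /lie /= /heis_lie /heis_omega big1 ?scale0r // => k _.
by rewrite !heisE mulr0 mul0r subrr.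
Qed.

Lemma lie_gg i j : lie (heis_g i) (heis_g j) = 0 :> heisenberg R n.
Proof.
rewrite /lie /= /heis_lie /heis_omega big1 ?scale0r // => k _.
by rewrite !heisE mulr0 mul0r subrr.
Qed.

Lemma lie_z u : lie u heis_z = 0.
Proof. by rewrite /lie /= /heis_lie heis_omegaz scale0r. Qed.

End HeisenbergBrackets.

(* With [n >= 1], the indices below 2(n-1) are those of f_1, ..., g_(n-1), and
   f_n, g_n, z sit at 2(n-1), 2(n-1)+1, 2(n-1)+2. *)
Definition soliton_gram (R : fieldType) (n : nat) (sigma : n.-1.-tuple R) :
    'M[R]_(n.*2.+1) :=
  \matrix_(i, j)
    let m := n.-1.*2 in
    if (i < m)%N then (if i == j then sigma`_(i./2) else 0)
    else if ((i : nat), (j : nat)) \in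
        [:: (m, m); (m.+1, m.+2); (m.+2, m.+1)] then 1 else 0.

(* Main.v *)
From HB Require Import structures.
Require Import Defs.
From mathcomp Require Import all_boot all_order all_algebra.
From mathcomp Require Import reals.
From mathcomp Require Import zify ring.

Import Order.TTheory GRing.Theory Num.Theory.

Local Open Scope ring_scope.

(** The bracket of the Heisenberg algebra is [u, v] = omega(u, v) z for a
    skew-symmetric form omega having z in its radical, and for the given inner
    product z is null.  These two facts are all that is used about the bracket;
    the coordinates only serve to exhibit one orthonormal basis.

    Write zeta = phi(z, .) and let J be the skew operator with
    phi(J u, w) = omega(u, w).  The Koszul formula gives
      2 nabla_u v = omega(u, v) z - zeta(v) J u - zeta(u) J v.
    Since J z = 0, zeta(z) = phi(z, z) = 0 and
    zeta(J u) = omega(u, z) = 0, composing two covariant derivatives kills most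
    terms; with b(u, w) = phi(J u, J w) what is left is
      4 R_{uv} w = (zeta(v) b(u, w) - zeta(u) b(v, w)) z
                   - zeta(w) zeta(u) J^2 v + zeta(w) zeta(v) J^2 u
    (lemma phi_curvature).  In the Ricci trace of R_{v u} v over an orthonormal
    basis, a factor zeta(v) contracts with another function linear in v and
    evaluates that function at z, which gives b(u, z) = 0, zeta(z) = 0 or
    J^2 z = 0.  Only the summand with b(v, v) survives:
      Ric u = (1/4) tr(b) zeta(u) z
    (lemma null_ricciE).  So Ric has image in the line of z, which is central,
    and kills z, which spans the derived algebra: each of the three terms of
    the derivation identity vanishes, and Ric = 0 Id + Ric is the soliton
    equation with eta = 0. *)

(** * Orthonormal bases of a Lorentzian form *)

Section OrthonormalBases.
Context {R : realFieldType} {V : lieAlgType R} {phi : {symmetric V}}.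
Implicit Types (e : seq V) (u v w : V).

Lemma symE u v : phi u v = phi v u.
Proof. by rewrite hermC expr0 mul1r. Qed.

Lemma onb_norm_nth {e} (eB : orthonormal_basis phi e) i : (i < size e)%N ->
  phi e`_i e`_i = if (i.+1 < size e)%N then 1 else -1.
Proof. by move=> lt_i; rewrite eB.2 // eqxx. Qed.

Lemma onb_norm_sqr {e} (eB : orthonormal_basis phi e) v : v \in e ->
  phi v v * phi v v = 1.
Proof.
case/(nthP 0)=> i lt_i <-; rewrite onb_norm_nth //.
by case: ifP; rewrite ?mulrNN mulr1.
Qed.

(** Parseval: the coordinate of u along v is phi u v / phi v v, and dividing
    by phi v v is the same as multiplying by it since it is 1 or -1. *)
Lemma onb_expansion {e} (eB : orthonormal_basis phi e) u :
  u = \sum_(v <- e) (phi v v * phi u v) *: v.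
Proof.
have [e_basis eO] := eB.
have ue : u \in <<in_tuple e>>%VS.
  by rewrite (span_basis (X := in_tuple e) e_basis) memvf.
have uE := coord_span ue.
rewrite (big_nth 0) big_mkord [LHS]uE; apply: eq_bigr => i _ /=.
congr (_ *: _); rewrite {2}uE linear_sumlz (bigD1 i) //= big1 => [|j ji].
  by rewrite addr0 linearZl_LR /= mulrCA (onb_norm_sqr eB) ?mulr1 ?mem_nth.
by rewrite linearZl_LR /= eO // ji mulr0.
Qed.

(** Applying g to the Parseval expansion of u. This is how every term of the
    Ricci trace that contains [phi z v] gets evaluated at z. *)
Lemma onb_contract {e} (eB : orthonormal_basis phi e) {g : V -> R} u :
  scalar g -> \sum_(v <- e) phi v v * (phi u v * g v) = g u.
Proof.
move=> g_lin.
pose G : {scalar V} := HB.pack g (GRing.isLinear.Build R V R _ g g_lin).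
have gZ a v : g (a *: v) = a * g v by exact: (linearZ_LR G).
rewrite [in RHS](onb_expansion eB u) -[g]/(G : V -> R) linear_sum.
by apply: eq_bigr => v _; rewrite [RHS]gZ mulrA.
Qed.

(** Contracting twice, once over each basis. The Ricci operator is to be
    computed over an arbitrary orthonormal basis, while its closed form refers
    to a chosen one. *)
Lemma onb_trace_indep {e e'} (eB : orthonormal_basis phi e)
    (e'B : orthonormal_basis phi e') {b : V -> V -> R} :
  (forall v, scalar (b ^~ v)) -> (forall u, scalar (b u)) ->
  \sum_(v <- e) phi v v * b v v = \sum_(v <- e') phi v v * b v v.
Proof.
move=> bl br.
transitivity (\sum_(v <- e) \sum_(w <- e')
    phi v v * (phi w w * (phi v w * b v w))).
  by apply: eq_bigr => v _; rewrite -mulr_sumr (onb_contract e'B _ (br v)).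
rewrite exchange_big; apply: eq_bigr => w _ /=.
rewrite -[in RHS](onb_contract eB _ (bl w)) mulr_sumr; apply: eq_bigr => v _.
by rewrite mulrCA [phi v w]symE.
Qed.

(** Reduces identities between vectors to scalar ones, which [ring] and [field]
    can settle. *)
Lemma onb_eq {e} (eB : orthonormal_basis phi e) u v :
  (forall w, phi u w = phi v w) -> u = v.
Proof.
move=> uv; rewrite (onb_expansion eB u) (onb_expansion eB v).
by apply: eq_bigr => w _; rewrite uv.
Qed.

(** Pairing a vanishing linear combination with one of the vectors isolates its
    coefficient up to sign, so the vectors are free. *)
Lemma orthonormal_basis_of_size e : size e = \dim {:V} ->
  (forall i j, (i < size e)%N -> (j < size e)%N ->
    phi e`_i e`_j =
      if i != j then 0 else if (i.+1 < size e)%N then 1 else -1) ->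
  orthonormal_basis phi e.
Proof.
move=> e_size eO; split=> //.
rewrite basisEfree subvf e_size leqnn !andbT.
apply/(freeP (X := in_tuple e)) => k k0 i.
have /= := congr1 (phi ^~ e`_i) k0.
rewrite linear0l linear_sumlz (bigD1 i) //= big1 => [|j ji].
  rewrite addr0 linearZl_LR /= eO // eqxx /=.
  by case: ifP => _; rewrite ?mulrN mulr1 // => /eqP; rewrite oppr_eq0 => /eqP.
by rewrite linearZl_LR /= eO // ji mulr0.
Qed.

(** The last vector of an orthonormal basis is the only negative one. *)
Lemma onb_lorentzian {e} : orthonormal_basis phi e -> (0 < \dim {:V})%N ->
  lorentzian phi.
Proof.
move=> eB dim_gt0; have [e_basis eO] := eB.
have e_size : size e = \dim {:V}.
  by rewrite -(size_basis (X := in_tuple e) e_basis).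
split.
  rewrite /nondegenerate -subv0; apply/subvP=> u /mem_orthovP u0.
  rewrite memv0; apply/eqP; apply: (onb_eq eB) => w.
  by rewrite linear0l u0 ?memvf.
exists e; have eN0 : 0 \notin e.
  apply/negP=> /(onb_norm_sqr eB); rewrite linear0l mul0r => /eqP.
  by rewrite eq_sym oner_eq0.
case/lastP: e eB e_basis eO e_size eN0 => [|s x] eB e_basis eO e_size eN0.
  by rewrite -e_size in dim_gt0.
have xx : phi x x = -1.
  have := onb_norm_nth eB (size s).
  by rewrite size_rcons ltnn nth_rcons ltnn eqxx; apply.
have ss v : v \in s -> phi v v = 1.
  case/(nthP 0)=> i lt_i <-; have := onb_norm_nth eB i.
  by rewrite size_rcons nth_rcons !ltnS lt_i; apply; apply: ltnW.
split=> //.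
- rewrite /pairwise_orthogonal eN0 /=.
  move: (rcons s x) eO => t; elim: t => //= v t IHt tO.
  rewrite IHt /= => [|i j lt_i lt_j]; last by have := tO i.+1 j.+1 lt_i lt_j.
  rewrite !andbT; apply/allP => w /(nthP 0) [j lt_j <-] /=.
  by have /= -> := tO 0%N j.+1 isT lt_j.
- rewrite -e_size size_rcons /= -cats1 count_cat /= xx ltr0N1 ?addn0.
  rewrite -[RHS](count_predT s); apply: eq_in_count => v /ss ->.
  exact: ltr01.
- rewrite -cats1 count_cat /= xx ltrN10 addn0.
  rewrite -[RHS]add0n; congr addn; rewrite -(count_pred0 s).
  by apply: eq_in_count => v /ss ->; rewrite ltNge ler01.
Qed.

End OrthonormalBases.

(** * Curvature of a bracket with values in a null central line *)

Section NullCentralBracket.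
Context {R : realFieldType} {V : lieAlgType R} {phi : {symmetric V}}.
Context {e0 : seq V} (e0B : orthonormal_basis phi e0).
Context {omega : {skew_symmetric V}} {z : V}.
Context (lieE : forall u v : V, lie u v = omega u v *: z).
Context (omegaz : forall u, omega u z = 0) (zz : phi z z = 0).
Implicit Types (u v w : V).

(** The operator J with phi (J u) w = omega u w, written with the basis e0 so
    that its existence needs no separate argument. *)
Definition omega_sharp u : V := \sum_(v <- e0) (phi v v * omega u v) *: v.

Local Notation J := omega_sharp.
Local Notation zeta := (phi z).

Lemma omega_sharp_linear : linear J.
Proof.
move=> a u v; rewrite /J scaler_sumr -big_split; apply: eq_bigr => w _ /=.
rewrite linearPl /= scalerA -scalerDl; congr (_ *: _); ring.
Qed.

HB.instance Definition _ := GRing.isLinear.Build R V V _ J omega_sharp_linear.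

Lemma skewE u v : omega u v = - omega v u.
Proof. by rewrite hermC expr1 mulN1r. Qed.

Lemma omega_zl v : omega z v = 0.
Proof. by rewrite skewE omegaz oppr0. Qed.

Lemma phi_omega_sharp u w : phi (J u) w = omega u w.
Proof.
have omega_lin : scalar (omega u) by move=> a x y; rewrite linearPr.
rewrite -[RHS](onb_contract e0B w omega_lin) /J linear_sumlz.
apply: eq_bigr => v _.
by rewrite linearZl_LR /= [phi v w]symE mulrAC mulrA.
Qed.

Lemma omega_sharp_z : J z = 0.
Proof.
by apply: (onb_eq e0B) => w; rewrite phi_omega_sharp omega_zl linear0l.
Qed.

(** The solution of the Koszul formula, read off after substituting
    [lie u v = omega u v *: z] and writing [omega u w] as [phi (J u) w]. *)
Definition null_connection u v : V :=
  2^-1 *: (omega u v *: z - zeta v *: J u - zeta u *: J v).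

Local Notation nabla := null_connection.

Lemma phi_nabla u v w : phi (nabla u v) w =
  2^-1 * (omega u v * zeta w - zeta v * omega u w - zeta u * omega v w).
Proof.
by rewrite linearZl_LR /= !linearBl /= !linearZl_LR /= !phi_omega_sharp.
Qed.

Lemma nabla_bilinear :
  bilinear_for (GRing.Scale.Law.clone _ _ *:%R _)
    (GRing.Scale.Law.clone _ _ *:%R _) nabla.
Proof.
split=> w a u v /=; apply: (onb_eq e0B) => x;
  rewrite linearPl /= !phi_nabla !(linearPl, linearPr) /=; ring.
Qed.

HB.instance Definition _ :=
  bilinear_isBilinear.Build R V V V _ _ nabla nabla_bilinear.

Lemma nabla_levi_civita : levi_civita phi nabla.
Proof.
move=> u v w; rewrite phi_nabla !lieE !linearZl_LR /=.
by rewrite (skewE w u) (skewE w v); field.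
Qed.

Lemma zeta_nabla u v : zeta (nabla u v) = 0.
Proof. by rewrite symE phi_nabla zz !omegaz !mulr0 !subrr mulr0. Qed.

Lemma omega_nabla u v w :
  omega (nabla u v) w =
    - 2^-1 * (zeta v * omega (J u) w + zeta u * omega (J v) w).
Proof.
rewrite linearZl_LR /= !linearBl /= !linearZl_LR /= omega_zl; ring.
Qed.

Definition sharp_form u v := phi (J u) (J v).

(** The term nabla_{[u, v]} w vanishes because nabla_z = 0, and the terms with
    the product [zeta u * zeta v] in J (J w) cancel in the commutator. *)
Lemma phi_curvature u v w x : phi (curvature nabla u v w) x =
  4^-1 * ((zeta v * sharp_form u w - zeta u * sharp_form v w) * zeta x
    - zeta w * zeta u * omega (J v) x + zeta w * zeta v * omega (J u) x).
Proof.
rewrite /curvature linearDl linearBl /= !phi_nabla !zeta_nabla.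
rewrite !(skewE _ (nabla _ _)) !omega_nabla !lieE.
rewrite !linearZl_LR linearZr_LR /= zz !omega_zl.
have JE a b : omega (J a) b = - sharp_form a b.
  by rewrite skewE -phi_omega_sharp symE.
have bC a b : sharp_form a b = sharp_form b a by rewrite /sharp_form symE.
rewrite !(JE w _, JE u v, JE v u) (bC w u) (bC w v) (bC v u).
by field.
Qed.

Lemma sharp_form_linearl v : scalar (sharp_form ^~ v).
Proof. by move=> a x y; rewrite /sharp_form linearP linearPl. Qed.

Lemma sharp_form_linearr u : scalar (sharp_form u).
Proof. by move=> a x y; rewrite /sharp_form linearP linearPr. Qed.

Definition sharp_trace : R := \sum_(v <- e0) phi v v * sharp_form v v.

(** In the Heisenberg case [sharp_trace] is twice the sum of the
    1 / sigma_i ^ 2. *)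
Definition null_ricci u : V := (4^-1 * sharp_trace * zeta u) *: z.

Lemma null_ricci_linear : linear null_ricci.
Proof.
move=> a u v; rewrite /null_ricci linearPr /= scalerA -scalerDl.
by congr (_ *: _); ring.
Qed.

HB.instance Definition _ :=
  GRing.isLinear.Build R V V _ null_ricci null_ricci_linear.

Lemma null_ricciE e u : orthonormal_basis phi e ->
  null_ricci u = \sum_(v <- e) phi v v *: curvature nabla v u v.
Proof.
move=> eB; apply: (onb_eq e0B) => x.
rewrite linear_sumlz linearZl_LR /= /sharp_trace.
rewrite (onb_trace_indep e0B eB sharp_form_linearl sharp_form_linearr).
have oJ_lin : scalar (fun v => omega (J v) x).
  by move=> a v w; rewrite linearP linearPl.
have zeta_lin : scalar zeta by move=> a v w; rewrite linearPr.
have sum_b := onb_contract eB z (sharp_form_linearr u).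
have sum_z := onb_contract eB z zeta_lin.
have sum_o := onb_contract eB z oJ_lin.
rewrite /= /sharp_form omega_sharp_z linear0r linear0l zz in sum_b sum_z sum_o.
(* Group the trace by the way v occurs: tr b survives, the other three sums
   are contractions at z and vanish. *)
transitivity (4^-1 * (zeta u * zeta x * (\sum_(v <- e) phi v v * sharp_form v v)
   - zeta x * (\sum_(v <- e) phi v v * (zeta v * sharp_form u v))
   - omega (J u) x * (\sum_(v <- e) phi v v * (zeta v * zeta v))
   + zeta u * (\sum_(v <- e) phi v v * (zeta v * omega (J v) x)))).
  rewrite /sharp_form sum_b sum_z sum_o; ring.
rewrite !mulr_sumr -!sumrB -big_split /= mulr_sumr; apply: eq_bigr => v _.
rewrite linearZl_LR /= phi_curvature; ring.
Qed.

Lemma null_ricci_operator : ricci_operator phi (linfun null_ricci).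
Proof.
exists nabla; split; first exact: nabla_levi_civita.
  by exists e0.
by move=> e eB u; rewrite lfunE /= (null_ricciE _ _ eB).
Qed.

(** All three terms vanish: z is central and [null_ricci z = 0]. *)
Lemma null_ricci_derivation : derivation (linfun null_ricci).
Proof.
move=> u v; rewrite !lfunE /= !lieE /null_ricci.
rewrite !(linearZl_LR, linearZr_LR) /= omega_zl omegaz zz.
by rewrite !mulr0 !scale0r addr0.
Qed.

End NullCentralBracket.

(** * The Heisenberg algebra and its Gram matrix *)

Section HeisenbergForms.
Context {R : fieldType} {n : nat}.
Local Notation h := (heisenberg R n).

HB.instance Definition _ := isBilinear.Build R h h R *%R (idfun \; *%R)
  (heis_omega : h -> h -> R)
  (fun v => zmod_morphism_linear (heis_omega_linearl v))
  (fun u => zmod_morphism_linear (heis_omega_linearr u))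
  (fun v => scalable_linear (heis_omega_linearl v))
  (fun u => scalable_linear (heis_omega_linearr u)).

Lemma heis_omega_skew (u v : h) :
  heis_omega u v = (-1) ^+ true * idfun (heis_omega v u).
Proof.
rewrite expr1 mulN1r /= /heis_omega -sumrN.
by apply: eq_bigr => i _; ring.
Qed.

HB.instance Definition _ := isHermitianSesquilinear.Build R h true idfun
  (heis_omega : h -> h -> R) heis_omega_skew.

Lemma dim_heisenberg : \dim {:h} = n.*2.+1.
Proof. by rewrite dimvf /dim /= mul1n. Qed.

End HeisenbergForms.

Section SolitonBasis.
Context {R : rcfType} {m : nat} (sigma : m.-tuple R).
Context (sigma_gt0 : forall i : 'I_m, 0 < tnth sigma i).
Local Notation h := (heisenberg R m.+1).
Context {phi : {symmetric h}}.
Context (phiE : forall i j : 'I_(m.+1.*2.+1),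
  phi (heis_basis i) (heis_basis j) = @soliton_gram R m.+1 sigma i j).

Local Notation E k := (heis_basis (inord k) : h).

(** The hyperbolic plane spanned by the null vectors g_n and z, with
    phi(g_n, z) = 1, has the unit vectors g_n / 2 + z and g_n / 2 - z of squares
    1 and -1; the other basis vectors only need to be normalised. *)
Definition soliton_onb_vec (k : nat) : h :=
  if (k < m.*2)%N then (Num.sqrt sigma`_k./2)^-1 *: E k
  else if k == m.*2 then E k
  else if k == m.*2.+1 then 2^-1 *: E m.*2.+1 + E m.*2.+2
  else 2^-1 *: E m.*2.+1 - E m.*2.+2.

Definition soliton_onb := mkseq soliton_onb_vec m.*2.+3.

Lemma phi_basis (i j : nat) : (i < m.*2.+3)%N -> (j < m.*2.+3)%N ->
  phi (E i) (E j) =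
    if (i < m.*2)%N then if i == j then sigma`_i./2 else 0
    else if (i, j) \in [:: (m.*2, m.*2); (m.*2.+1, m.*2.+2); (m.*2.+2, m.*2.+1)]
         then 1 else 0.
Proof.
move=> lt_i lt_j; rewrite phiE mxE -[inord i == _]val_eqE /= !inordK //.
Qed.

Lemma soliton_onb_orthonormal : orthonormal_basis phi soliton_onb.
Proof.
apply: orthonormal_basis_of_size; first by rewrite size_mkseq dim_heisenberg.
rewrite size_mkseq => i j lt_i lt_j; rewrite !nth_mkseq //.
wlog le_ij : i j lt_i lt_j / (i <= j)%N.
  move=> IH; have [/IH -> //|/ltnW le_ji] := leqP i j.
  rewrite symE IH // [i == j]eq_sym; case: eqP => // -> //.
(* Both vectors in the diagonal block. *)
have [lt_j2|ge_j] := ltnP j m.*2.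
  have lt_i2 := leq_ltn_trans le_ij lt_j2.
  rewrite /soliton_onb_vec lt_i2 lt_j2 linearZl_LR linearZr_LR /=.
  rewrite phi_basis // lt_i2.
  have [<-|_] := eqVneq i j; last by rewrite !mulr0.
  have lt_i' : (i./2 < m)%N by lia.
  have := sigma_gt0 (Ordinal lt_i'); rewrite (tnth_nth 0) /= => s_gt0.
  rewrite ifT; last by lia.
  rewrite -{3}(sqr_sqrtr (ltW s_gt0)) expr2; field.
  by rewrite sqrtr_eq0 -ltNge.
(* By i <= j, only i can still lie in the diagonal block. *)
have [lt_i2|ge_i] := ltnP i m.*2.
  have -> : (i != j) = true by lia.
  have phi0 k : (m.*2 <= k < m.*2.+3)%N -> phi (E i) (E k) = 0.
    by case/andP=> ge_k lt_k; rewrite phi_basis // lt_i2 ifF //; lia.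
  rewrite /soliton_onb_vec lt_i2 ltnNge ge_j /= linearZl_LR /=.
  case: ifP => [_|nj]; first by rewrite phi0 ?mulr0 //; lia.
  case: ifP => _; rewrite (linearBr, linearDr) linearZr_LR /= !phi0
    ?mulr0 ?subrr ?addr0 ?mulr0 //; lia.
(* The Lorentzian block, re-indexed from 0. *)
have phi_ij k l : (k < 3)%N -> (l < 3)%N ->
    phi (E (m.*2 + k)) (E (m.*2 + l)) =
    if (k, l) \in [:: (0, 0); (1, 2); (2, 1)]%N then 1 else 0.
  move=> lt_k lt_l; rewrite phi_basis; try lia.
  rewrite ltnNge leq_addr /= !inE !xpair_eqE.
  congr (if _ then _ else _); lia.
have onbE k : soliton_onb_vec (m.*2 + k) =
    if k == 0%N then E (m.*2 + 0)
    else if k == 1%N then 2^-1 *: E (m.*2 + 1) + E (m.*2 + 2)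
    else 2^-1 *: E (m.*2 + 1) - E (m.*2 + 2).
  rewrite /soliton_onb_vec ltnNge leq_addr /=.
  have -> : (m.*2 + k == m.*2)%N = (k == 0%N) by lia.
  have -> : (m.*2 + k == m.*2.+1)%N = (k == 1%N) by lia.
  by case: eqP => [->|_] //; rewrite addn1 addn2.
have [k ik]: exists k, i = (m.*2 + k)%N by exists (i - m.*2)%N; lia.
have [l jl]: exists l, j = (m.*2 + l)%N by exists (j - m.*2)%N; lia.
have lt_k : (k < 3)%N by lia.
have lt_l : (l < 3)%N by lia.
rewrite ik jl eqn_add2l !onbE -addnS -[m.*2.+3]addn3 ltn_add2l.
case: k lt_k {ik} => [|[|[|//]]] _; case: l lt_l {jl} => [|[|[|//]]] _ /=;
  rewrite ?(linearBl, linearDl) /= ?linearZl_LR ?(linearBr, linearDr) /=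
    ?linearZr_LR /= !phi_ij //=; by field.
Qed.

Lemma phi_center : phi heis_z heis_z = 0.
Proof.
have -> : heis_z = E m.*2.+2.
  by congr heis_basis; apply/val_inj; rewrite /= inordK.
rewrite phi_basis // !ifF //; rewrite ?inE ?xpair_eqE; lia.
Qed.

End SolitonBasis.

Theorem theorem3p13 (R : realType) (n : nat) (n_ge1 : (1 <= n)%N)
    (sigma : n.-1.-tuple R) (sigma_sorted : sorted >=%R sigma)
    (sigma_ge1 : forall i : 'I_n.-1, 1 <= tnth sigma i)
    (phi : {symmetric (heisenberg R n)})
    (phiE : forall i j : 'I_(n.*2.+1),
       phi (heis_basis i) (heis_basis j) = soliton_gram sigma i j) :
  exists Ric : 'End(heisenberg R n),
    [/\ ricci_operator phi Ric,
        derivation Ric,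
        algebraic_ricci_soliton_with phi 0 Ric &
        steady_algebraic_ricci_soliton phi].
Proof.
case: n n_ge1 sigma sigma_sorted sigma_ge1 phi phiE => // m _ sigma _ sigma_ge1.
move=> phi phiE.
have sigma_gt0 i : 0 < tnth sigma i := lt_le_trans ltr01 (sigma_ge1 i).
have eB := soliton_onb_orthonormal sigma sigma_gt0 phiE.
have zz := phi_center sigma phiE.
have lieE (u v : heisenberg R m.+1) : lie u v = heis_omega u v *: heis_z by [].
have RicP := null_ricci_operator eB lieE heis_omegaz zz.
set Ric := linfun _ in RicP.
have RicD : derivation Ric := null_ricci_derivation lieE heis_omegaz zz.
have Ric_soliton : algebraic_ricci_soliton_with phi 0 Ric.
  split=> //; first by apply: (onb_lorentzian eB); rewrite dim_heisenberg.
  by exists Ric; rewrite ?scale0r ?add0r.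
by exists Ric; split=> //; exists Ric.
Qed.
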